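(* Let $\mu\in\mathbb{R}$, $\sigma>0$ and $\alpha\in\mathbb{R}$. If $Y\sim LSN(\mu,\sigma^2,\alpha)$, then the entropy of $Y$ is $$H_{LSN(\mu,\sigma^2,\alpha)}=H_{SN(\mu,\sigma^2,\alpha)}+E(X),$$ where $X\sim SN(\mu,\sigma^2,\alpha)$, $H_{SN(\mu,\sigma^2,\alpha)}$ is the entropy of $X$, and $$E(X)=\mu+\sigma\sqrt{\frac{2}{\pi}}\,\frac{\alpha}{\sqrt{1+\alpha^2}}.$$
   Context: The (Shannon, differential) entropy of a continuous random vector $\mathbf{Z}$ with density $f_{\mathbf{Z}}$ is $H_{\mathbf{Z}}=-E[\ln f_{\mathbf{Z}}(\mathbf{Z})]$; $H_{D}$ denotes the entropy of a random variable with distribution $D$. Let $\phi$ and $\Phi$ be the density and cumulative distribution function of the standard normal distribution $N(0,1)$. Skew-normal distribution: $X\sim SN(\mu,\sigma^2,\alpha)$, with location $\mu\in\mathbb{R}$, scale $\sigma^2>0$ and shape $\alpha\in\mathbb{R}$, means that $X$ has density $$f(z)=\frac{2}{\sigma}\,\phi\left(\frac{z-\mu}{\sigma}\right)\Phi\left(\alpha\,\frac{z-\mu}{\sigma}\right),\quad z\in\mathbb{R}.$$ Log-skew-normal distribution: $Y\sim LSN(\mu,\sigma^2,\alpha)$ means that $Y=\exp(X)$ with $X\sim SN(\mu,\sigma^2,\alpha)$; equivalently, $Y$ has density $$f(y)=\frac{2}{\sigma y}\,\phi\left(\frac{\ln y-\mu}{\sigma}\right)\Phi\left(\alpha\,\frac{\ln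 y-\mu}{\sigma}\right),\quad y>0.$$ *)

(* Defs.v *)
From HB Require Import structures.
From mathcomp Require Import all_boot all_order all_algebra.
From mathcomp Require Import all_classical all_reals all_analysis.
From mathcomp Require Import measurable_realfun.

Set Implicit Arguments.
Unset Strict Implicit.
Unset Printing Implicit Defensive.

Import Order.TTheory GRing.Theory Num.Theory.
Import numFieldNormedType.Exports.

Local Open Scope classical_set_scope.
Local Open Scope ring_scope.

Definition has_density {d} {T : measurableType d} {R : realType}
    (P : probability T R) (Z : {RV P >-> R}) (f : R -> R) : Prop :=
  [/\ measurable_fun setT f, (forall x, 0 <= f x) &
      forall A : set R, measurable A ->
        (distribution P Z A = \int[lebesgue_measure]_(x in A) (f x)%:E)%E].

(* A choice of density; the zero function if [Z] has no density. *)
Definition density {d} {T : measurableType d} {R : realType}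
    (P : probability T R) (Z : {RV P >-> R}) : R -> R :=
  xget (cst 0) (has_density Z).

(* Extended-real valued, so that no integrability assumption is needed. Every
   version of the density gives the same value, see [entropyE]. The convention
   [ln 0 = 0] is harmless: the density vanishes at [Z] with probability 0. *)
Definition entropy {d} {T : measurableType d} {R : realType}
    (P : probability T R) (Z : {RV P >-> R}) : \bar R :=
  (- 'E_P[fun w => ln (density Z (Z w))])%E.

Lemma has_density_ae_eq {d} {T : measurableType d} {R : realType}
    (P : probability T R) (Z : {RV P >-> R}) (f g : R -> R) :
  has_density Z f -> has_density Z g ->
  ae_eq lebesgue_measure setT (EFin \o f) (EFin \o g).
Proof.
move=> [mf f0 If] [mg g0 Ig].
apply: integral_ae_eq => //; last by move=> E _ mE; rewrite -If// -Ig.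
- apply/integrableP; split; first exact/measurable_EFinP.
  under eq_integral do rewrite /= ger0_norm//.
  by rewrite -If// probability_setT ltry.
- exact/measurable_EFinP.
Qed.

Lemma entropyE {d} {T : measurableType d} {R : realType}
    (P : probability T R) (Z : {RV P >-> R}) (f : R -> R) :
  has_density Z f -> entropy Z = (- 'E_P[fun w => ln (f (Z w))])%E.
Proof.
move=> Zf; have Zg : has_density Z (density Z) by exact: (xgetI _ Zf).
have mlnZ g : has_density Z g ->
    measurable_fun setT (fun w => (ln (g (Z w)))%:E).
  move=> [mg _ _]; apply/measurable_EFinP.
  by apply: measurableT_comp => //; exact: measurableT_comp.
rewrite /entropy unlock; congr (- _)%E.
apply: ae_eq_integral => //=; [exact: mlnZ|exact: mlnZ|].
have [N [mN N0 subN]] := has_density_ae_eq Zg Zf.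
exists (Z @^-1` N); split.
- by rewrite -[X in measurable X]setTI; exact: measurable_funPT.
- case: Zf => mf _ If; apply: (etrans (If N mN)).
  apply: null_set_integral => //; apply: measurable_funTS.
  exact/measurable_EFinP.
- move=> w /= nw; apply: subN => /= e; apply: nw => _.
  by move: (e Logic.I) => -[->].
Qed.

Definition std_normal_pdf {R : realType} (x : R) : R := normal_pdf 0 1 x.

Definition std_normal_cdf {R : realType} (x : R) : R :=
  fine (normal_prob (0 : R) 1 `]-oo, x]).

Definition skew_normal_pdf {R : realType} (mu sigma alpha z : R) : R :=
  2 / sigma * std_normal_pdf ((z - mu) / sigma)
            * std_normal_cdf (alpha * ((z - mu) / sigma)).

(* [X ~ SN(mu, sigma^2, alpha)]; the parameter is the square root [sigma] of
   the scale. *)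
Definition skew_normal {d} {T : measurableType d} {R : realType}
    (P : probability T R) (X : {RV P >-> R}) (mu sigma alpha : R) : Prop :=
  has_density X (skew_normal_pdf mu sigma alpha).

(* [Y ~ LSN(mu, sigma^2, alpha)]. With an almost sure equality, this only
   depends on the law of [Y]. *)
Definition log_skew_normal {d} {T : measurableType d} {R : realType}
    (P : probability T R) (Y : {RV P >-> R}) (mu sigma alpha : R) : Prop :=
  exists2 X : {RV P >-> R}, skew_normal X mu sigma alpha &
    {ae P, forall w, Y w = expR (X w)}.

(* Main.v *)
Require Import Defs.
From HB Require Import structures.
From mathcomp Require Import all_boot all_order all_algebra.
From mathcomp Require Import all_classical all_reals all_analysis.
From mathcomp Require Import measurable_realfun ring lra.

Set Implicit Arguments.
Unset Strict Implicit.
Unset Printing Implicit Defensive.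

Import Order.TTheory GRing.Theory Num.Theory.
Import numFieldNormedType.Exports.

Local Open Scope classical_set_scope.
Local Open Scope ring_scope.

(** The entropy formula is the change of variables [y = exp x] in disguise. If
    [X] has a continuous density [f] and [Y = exp X] almost surely, then [Y]
    has the density [g y = f (ln y) / y] on the positive reals
    ([has_density_expR]), so that [ln (g Y) = ln (f X) - X] almost surely.
    Taking expectations gives [H(Y) = H(X) + E(X)] as soon as [X] is integrable
    ([entropy_expR]). The entropy of [X] is an extended real, possibly infinite
    at this level of generality; the expectation still splits, because adding
    an integrable function preserves the finiteness of the integrals of the
    positive part and of the negative part ([integralDr_integrable]).

    The two variables of the theorem, [X] and the logarithm of [Y], may live on
    different probability spaces. Both have the same density, and the
    expectation of any measurable function of a variable with density [f] is an
    integral against [f] ([expectation_density]); hence they have the same mean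
    and the same entropy.

    The mean is obtained by integrating an exact derivative. Let [S] be the
    skew-normal density, [N m s] the density of the normal law with mean [m]
    and standard deviation [s], and [s = sigma / sqrt (1 + alpha^2)]. Since
    [S = 2 * N mu sigma * Phi] with [Phi] evaluated at
    [alpha * (x - mu) / sigma], the function [- sigma^2 * S] has derivative
    [(x - mu) * S x - 2 * sigma * c * N mu s x] with
    [c = alpha / sqrt (2 * pi * (1 + alpha^2))]: the product of the two Gaussian
    factors [N mu sigma] and [phi] is again Gaussian
    ([normal_pdf_mul_std_normal_pdf]). As [S] vanishes at both infinities, the
    integral of this derivative over the line is [0], so that
    [E(X) - mu = 2 * sigma * c]. *)

(** * Expectations of functions of a variable with a density *)

Section density_expectation.
Context {R : realType}.
Notation leb := (@lebesgue_measure R).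
Implicit Types f h : R -> R.

(** The law of [X] is absolutely continuous, and [f] agrees almost everywhere
    with its Radon-Nikodym derivative, for which this formula is known. *)
Lemma ge0_expectation_density {d} {T : measurableType d}
    (P : probability T R) (X : {RV P >-> R}) f (h : R -> \bar R) :
  has_density X f -> measurable_fun setT h -> (forall x, 0 <= h x)%E ->
  (\int[P]_w h (X w) = \int[leb]_x (h x * (f x)%:E))%E.
Proof.
move=> [mf f0 If] mh h0.
(* Lebesgue measure is defined on the measurable type [measurableTypeR R], and
   a Radon-Nikodym derivative relates two measures on the same type. *)
pose Xb : T -> measurableTypeR R := X.
have mXb : measurable_fun setT Xb by exact: (@measurable_funPT _ _ _ _ X).
pose XbM := isMeasurableFun.Build _ _ _ _ _ mXb.
pose Xb' : {mfun T >-> measurableTypeR R} := HB.pack Xb XbM.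
pose nu : {finite_measure set (measurableTypeR R) -> \bar R} := distribution P Xb'.
have nuE A : measurable A -> nu A = (\int[leb]_(x in A) (f x)%:E)%E.
  exact: If.
have nuleb : nu `<< leb.
  apply/null_content_dominatesP => A mA A0; rewrite nuE//.
  by apply: null_set_integral => //; apply: measurable_funTS; exact/measurable_EFinP.
rewrite -(ge0_integral_distribution Xb')//.
rewrite -(Radon_Nikodym_SigmaFinite.change_of_variables nuleb)//.
have iRN := Radon_Nikodym_SigmaFinite.f_integrable nuleb.
apply: ae_eq_integral => //.
- by apply: emeasurable_funM => //; exact: measurable_int iRN.
- by apply: emeasurable_funM => //; exact/measurable_EFinP.
- apply: ae_eqe_mul2l; apply: integral_ae_eq => //.
  + exact/measurable_EFinP.
  + by move=> E _ mE; rewrite -Radon_Nikodym_SigmaFinite.f_integral// nuE.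
Qed.

(** Since [f] is nonnegative, the positive and negative parts of [h * f] are
    those of [h] times [f]; so the two sides are the same difference of extended
    reals, even when both terms are infinite. This is what makes expectation
    and entropy depend on the density alone. *)
Lemma expectation_density {d} {T : measurableType d}
    (P : probability T R) (X : {RV P >-> R}) f h :
  has_density X f -> measurable_fun setT h ->
  ('E_P[h \o X] = \int[leb]_x (h x * f x)%:E)%E.
Proof.
move=> Xf mh; have [mf f0 _] := Xf.
have mh' : measurable_fun setT (EFin \o h) by exact/measurable_EFinP.
have posE x :
    ((fun x => (h x * f x)%:E)^\+ x = (EFin \o h)^\+ x * (f x)%:E)%E.
  by rewrite !funeposE [RHS]maxe_pMl ?lee_fin// mul0e EFinM.
have negE x :
    ((fun x => (h x * f x)%:E)^\- x = (EFin \o h)^\- x * (f x)%:E)%E.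
  by rewrite !funenegE [RHS]maxe_pMl ?lee_fin// mul0e mulNe EFinM.
rewrite unlock integralE [RHS]integralE; congr (_ - _)%E.
- transitivity (\int[P]_w ((EFin \o h)^\+ (X w)))%E.
    by apply: eq_integral => w _; rewrite !funeposE.
  rewrite (ge0_expectation_density Xf)//; last exact: measurable_funepos.
  by apply: eq_integral => x _; rewrite posE.
- transitivity (\int[P]_w ((EFin \o h)^\- (X w)))%E.
    by apply: eq_integral => w _; rewrite !funenegE.
  rewrite (ge0_expectation_density Xf)//; last exact: measurable_funeneg.
  by apply: eq_integral => x _; rewrite negE.
Qed.

Lemma integrable_density {d} {T : measurableType d}
    (P : probability T R) (X : {RV P >-> R}) f h :
  has_density X f -> measurable_fun setT h ->
  leb.-integrable setT (fun x => (h x * f x)%:E) ->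
  P.-integrable setT (fun w => (h (X w))%:E).
Proof.
move=> Xf mh /integrableP[_ foo]; have [mf f0 _] := Xf.
apply/integrableP; split.
  by apply/measurable_EFinP; exact: measurableT_comp.
rewrite (ge0_expectation_density Xf (h := fun x => `|(h x)%:E|%E))//.
  apply: le_lt_trans foo; rewrite le_eqVlt; apply/orP; left; apply/eqP.
  by apply: eq_integral => x _; rewrite /= normrM (ger0_norm (f0 x)) EFinM.
by apply/measurableT_comp => //; exact/measurable_EFinP.
Qed.

Lemma density_gt0_ae {d} {T : measurableType d}
    (P : probability T R) (X : {RV P >-> R}) f :
  has_density X f -> {ae P, forall w, 0 < f (X w)}.
Proof.
move=> [mf f0 If].
have mA : measurable (f @^-1` [set 0]) by rewrite -[X in measurable X]setTI; exact: mf.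
exists (X @^-1` (f @^-1` [set 0])); split.
- by rewrite -[X in measurable X]setTI; exact: measurable_funPT.
- apply: (etrans (If _ mA)); rewrite integral0_eq// => x /= ->//.
- by move=> w /= /negP; rewrite lt_neqAle f0 andbT negbK eq_sym => /eqP.
Qed.

End density_expectation.

(** * Adding an integrable function under the integral *)

Section integralD_any.
Context {d} {T : measurableType d} {R : realType} (mu : {measure set T -> \bar R}).
Local Open Scope ereal_scope.

Let integral_funeposD_lty (k h : T -> R) :
  measurable_fun setT k -> mu.-integrable setT (EFin \o h) ->
  \int[mu]_x (EFin \o k)^\+ x < +oo ->
  \int[mu]_x (EFin \o (k \+ h)%R)^\+ x < +oo.
Proof.
move=> mk ih ik; have mh := measurable_int _ ih.
have mh' : measurable_fun setT h by exact/measurable_EFinP.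
have mk' : measurable_fun setT (EFin \o k) by exact/measurable_EFinP.
apply: (@le_lt_trans _ _ (\int[mu]_x ((EFin \o k)^\+ x + (EFin \o h)^\+ x))).
  apply: ge0_le_integral => //.
  - apply: measurable_funepos; apply/measurable_EFinP; exact: measurable_funD.
  - by apply: emeasurable_funD; exact: measurable_funepos.
  - move=> x _; rewrite !funeposE/= -!EFin_max -EFinD lee_fin ge_max.
    by rewrite lerD ?le_max ?lexx//= addr_ge0// le_max lexx orbT.
rewrite ge0_integralD//; [|exact: measurable_funepos..].
by rewrite lte_add_pinfty//; exact: integral_funepos_lt_pinfty.
Qed.

(** Each of [k] and [k + h] is the other plus an integrable function, so that
    their positive (resp. negative) parts have infinite integrals
    simultaneously. If [k] is not integrable, both sides are therefore the same
    infinite value, with the convention [+oo - oo = -oo]. This form keeps an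
    entropy that may be infinite inside the equation. *)
Lemma integralDr_integrable (k h : T -> R) :
  measurable_fun setT k -> mu.-integrable setT (EFin \o h) ->
  \int[mu]_x (k x + h x)%:E = \int[mu]_x (k x)%:E + \int[mu]_x (h x)%:E.
Proof.
move=> mk ih; have mh : measurable_fun setT h.
  by have := measurable_int _ ih => /measurable_EFinP.
have mkh : measurable_fun setT (k \+ h)%R by exact: measurable_funD.
have ihN : mu.-integrable setT (EFin \o (\- h)%R).
  exact: (integrableN ih).
have kE : k = ((k \+ h) \+ (\- h))%R by apply/funext => x /=; rewrite addrK.
have posE : (\int[mu]_x (EFin \o (k \+ h)%R)^\+ x < +oo) =
            (\int[mu]_x (EFin \o k)^\+ x < +oo).
  apply/idP/idP; last exact: integral_funeposD_lty.
  by move=> ?; rewrite kE; exact: integral_funeposD_lty.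
have NE (u : T -> R) : (EFin \o u)^\- = (EFin \o (\- u)%R)^\+.
  by apply/funext => x; rewrite funenegE funeposE.
have negE : (\int[mu]_x (EFin \o (k \+ h)%R)^\- x < +oo) =
            (\int[mu]_x (EFin \o k)^\- x < +oo).
  rewrite !NE; have -> : (\- (k \+ h))%R = ((\- k) \+ (\- h))%R.
    by apply/funext => x /=; rewrite opprD.
  have mNk : measurable_fun setT (\- k)%R by exact: measurableT_comp.
  have mNh : measurable_fun setT (\- h)%R by exact: measurableT_comp.
  apply/idP/idP; last exact: integral_funeposD_lty.
  move=> ?; have -> : (\- k = ((\- k) \+ (\- h)) \+ h)%R.
    by apply/funext => x /=; rewrite subrK.
  by apply: integral_funeposD_lty => //; exact: (measurable_funD mNk mNh).
have [ik|nik] := pselect (mu.-integrable setT (EFin \o k)).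
  exact: integralD_EFin.
have /fineK <- := integrable_fin_num measurableT ih.
have neg_ge0 (u : T -> \bar R) : 0 <= \int[mu]_x u^\- x.
  by apply: integral_ge0.
have nlty (a : \bar R) : (a < +oo) = false -> a = +oo.
  by move=> /negbT; rewrite ltey negbK => /eqP.
rewrite integralE [in RHS]integralE -/(EFin \o k) -/(EFin \o (k \+ h)%R).
have [b|b] := boolP (\int[mu]_x (EFin \o k)^\- x < +oo); last first.
  rewrite (nlty _ (negbTE b)) (nlty (\int[mu]_x (EFin \o (k \+ h)%R)^\- x)).
    by rewrite !addeNy.
  by rewrite negE (negbTE b).
have [a|a] := boolP (\int[mu]_x (EFin \o k)^\+ x < +oo).
  exfalso; apply: nik; apply/integrableP; split; first exact/measurable_EFinP.
  rewrite (_ : (fun x => _) = (EFin \o k)^\+ \+ (EFin \o k)^\-); last first.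
    exact: (fune_abse (EFin \o k)).
  rewrite ge0_integralD//; [|exact/measurable_funepos/measurable_EFinP
                            |exact/measurable_funeneg/measurable_EFinP].
  exact: lte_add_pinfty.
rewrite (nlty _ (negbTE a)) (nlty (\int[mu]_x (EFin \o (k \+ h)%R)^\+ x)); last first.
  by rewrite posE (negbTE a).
have /fineK <- : \int[mu]_x (EFin \o k)^\- x \is a fin_num by rewrite ge0_fin_numE.
have /fineK <- : \int[mu]_x (EFin \o (k \+ h)%R)^\- x \is a fin_num.
  by rewrite ge0_fin_numE// negE.
by [].
Qed.

End integralD_any.

(** * The density of the exponential of a random variable *)

Section substitution_ln.
Context {R : realType}.
Notation leb := (@lebesgue_measure R).

Lemma derive1_ln (x : R) : 0 < x -> (@ln R)^`()%classic x = x^-1.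
Proof. by move=> x0; rewrite derive1E; have [_ ->] := is_derive1_ln x0. Qed.

Lemma ge0_integral_substitution_ln (f : R -> R) (a : R) :
  0 < a -> continuous f -> (forall x, 0 <= f x) ->
  (\int[leb]_(x in `[ln a, +oo[) (f x)%:E =
   \int[leb]_(y in `[a, +oo[) (f (ln y) / y)%:E)%E.
Proof.
move=> a0 cf f0; have gta0 (x : R) : a <= x -> 0 < x := lt_le_trans a0.
have derivable_ln (x : R) : 0 < x -> derivable (@ln R) x 1.
  by move=> x0; apply: ex_derive; exact: is_derive1_ln.
have lnV_near (x : R) : 0 < x -> \forall y \near x, y^-1 = (@ln R)^`()%classic y.
  move=> x0; near=> y; rewrite derive1_ln//; near: y; exact: lt_nbhsr.
rewrite (@increasing_ge0_integration_by_substitutiony _ (@ln R) f a)//.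
- apply: eq_integral => y; rewrite inE/= in_itv/= andbT => /gta0 y0.
  by rewrite /= -[X in X%:E]/(f (ln y) * _) derive1_ln.
- move=> x y; rewrite !in_itv/= !andbT => /gta0 x0 /gta0 y0 xy.
  by rewrite ltr_ln.
- move=> x; rewrite in_itv/= andbT => /ltW/gta0 x0.
  rewrite /continuous_at derive1_ln//; apply: cvg_trans.
    by apply: near_eq_cvg; exact: lnV_near.
  by apply: cvgV; [rewrite gt_eqF|exact: cvg_id].
- apply/cvg_ex; exists a^-1; apply: cvg_trans.
    apply: near_eq_cvg; near=> y; rewrite [RHS]derive1_ln//.
    by apply: gta0; near: y; exact: nbhs_right_ge.
  by apply: cvgV; [rewrite gt_eqF|exact: cvg_at_right_filter].
- apply/cvg_ex; exists 0; apply: cvg_trans.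
    apply: near_eq_cvg; near=> y; rewrite [RHS]derive1_ln//; near: y; exact: nbhs_pinfty_gt.
  by apply/gtr0_cvgV0; [exact: nbhs_pinfty_gt|exact: cvg_id].
- split; first by move=> x; rewrite in_itv/= andbT => /ltW/gta0; exact: derivable_ln.
  by apply: cvg_at_right_filter; exact: continuous_ln.
- apply/cvgryPge => M; near=> y.
  have ley : expR M <= y by near: y; exact: nbhs_pinfty_ge.
  by rewrite -ler_expR lnK// posrE (lt_le_trans (expR_gt0 M)).
- by apply: continuous_subspaceT.
Unshelve. all: by end_near. Qed.

End substitution_ln.

Section exp_density.
Context {R : realType}.
Notation leb := (@lebesgue_measure R).
Implicit Types f g : R -> R.

(** The closed right half-lines form a pi-system that generates the Borel sets
    and covers the line; a finite measure is determined by its values on such a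
    system. *)
Lemma has_density_itvcy {d} {T : measurableType d}
    (P : probability T R) (Y : {RV P >-> R}) g :
  measurable_fun setT g -> (forall x, 0 <= g x) ->
  (forall a, distribution P Y `[a, +oo[ = \int[leb]_(y in `[a, +oo[) (g y)%:E)%E ->
  has_density Y g.
Proof.
move=> mg g0 Yg; split => // A mA.
pose m (B : set R) := (\int[leb]_(y in B) (g y)%:E)%E.
have m0 : m set0 = 0%E by rewrite /m integral_set0.
have m_ge0 B : (0 <= m B)%E by apply: integral_ge0 => x _; rewrite lee_fin.
have m_add : semi_sigma_additive m.
  move=> F mF tF mUF; rewrite /m ge0_integral_bigcup//=.
  - by apply: is_cvg_ereal_nneg_natsum_cond => n _ _; exact: m_ge0.
  - by apply: measurable_funTS; exact/measurable_EFinP.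
  - by move=> x _; rewrite lee_fin.
pose mM := isMeasure.Build _ R R m m0 m_ge0 m_add.
pose m' : {measure set R -> \bar R} := HB.pack m mM.
apply: (@g_sigma_algebra_measure_unique _ _ _ (@RGenCInfty.G R) _
  (fun n => `[- n%:R, +oo[%classic) _ _ (distribution P Y) m') => //.
- by move=> _ [x ->]; exact: measurable_itv.
- by move=> n; exists (- n%:R).
- apply/seteqP; split=> // x _; exists (Num.bound `|x|) => //=.
  rewrite in_itv/= andbT lerNl (le_trans (ler_norm (- x)))// normrN.
  by rewrite ltW// archi_boundP.
- move=> _ _ [x ->] [y ->]; exists (Num.max x y).
  apply/seteqP; split=> z /=; rewrite !in_itv/= !andbT ge_max.
    by move=> [-> ->].
  by move=> /andP[-> ->].
- by move=> _ [x ->]; exact: Yg.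
- by move=> k; rewrite ltey_eq fin_num_measure.
- exact: (eq_ind _ (fun F : set (set R) => F A) mA _ (@RGenCInfty.measurableE R)).
Qed.

Lemma ae_eq_distribution {d} {T : measurableType d} (P : probability T R)
    (X Y : {RV P >-> R}) (A : set R) :
  {ae P, forall w, X w = Y w} -> measurable A ->
  distribution P X A = distribution P Y A.
Proof.
move=> XY mA.
have mpre (Z : {RV P >-> R}) : measurable (Z @^-1` A).
  by rewrite -[X in measurable X]setTI; exact: measurable_funPT.
rewrite /distribution /pushforward.
have PE (Z : {RV P >-> R}) : P (Z @^-1` A) = (\int[P]_w (\1_(Z @^-1` A) w)%:E)%E.
  by rewrite integral_indic// setIT.
rewrite [LHS]PE [RHS]PE; apply: ae_eq_integral => //.
- exact/measurable_EFinP/measurable_indic.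
- exact/measurable_EFinP/measurable_indic.
- apply: filterS XY => w /= XYw _; rewrite !indicE; congr ((nat_of_bool _)%:R%:E).
  by apply/idP/idP; rewrite !inE /= XYw.
Qed.

(** The indicator function is needed because [ln] is [0], not undefined, on the
    nonpositive reals. *)
Definition exp_density f y : R := f (ln y) / y * \1_`]0, +oo[ y.

Lemma exp_densityE f y : 0 < y -> exp_density f y = f (ln y) / y.
Proof. by move=> y0; rewrite /exp_density indicE mem_set ?mulr1//= in_itv/= y0. Qed.

Lemma exp_density_le0 f y : y <= 0 -> exp_density f y = 0.
Proof.
move=> y0; rewrite /exp_density indicE memNset ?mulr0//=.
by rewrite in_itv/= andbT ltNge y0.
Qed.

Lemma exp_density_ge0 f y : (forall x, 0 <= f x) -> 0 <= exp_density f y.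
Proof.
move=> f0; have [y0|y0] := leP y 0; first by rewrite exp_density_le0.
by rewrite exp_densityE// divr_ge0// ltW.
Qed.

Lemma measurable_exp_density f :
  measurable_fun setT f -> measurable_fun setT (exp_density f).
Proof.
move=> mf.
have -> : exp_density f =
    (fun y => f (ln y) * expR (- ln y) * \1_`]0, +oo[ y).
  apply/funext => y; have [y0|y0] := leP y 0.
    rewrite exp_density_le0// indicE memNset ?mulr0//=.
    by rewrite in_itv/= andbT ltNge y0.
  rewrite exp_densityE// indicE mem_set ?mulr1//= ?in_itv/= ?y0//.
  by rewrite expRN lnK.
apply: measurable_funM; last exact: measurable_indic.
apply: measurable_funM; first by apply: (measurableT_comp mf); exact: measurable_ln.
apply: measurableT_comp => //; apply: measurableT_comp => //.
Qed.

(** It is enough to compare the masses of the right half-lines. From a point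
    [a > 0], the substitution [x = ln y] applies. From a point [a <= 0], both
    masses are that of the open half-line of positive reals, on which [Y] is
    concentrated, and continuity of measures lets [a] decrease to [0]. *)
Lemma has_density_expR {d} {T : measurableType d} (P : probability T R)
    (X Y : {RV P >-> R}) f :
  has_density X f -> continuous f -> {ae P, forall w, Y w = expR (X w)} ->
  has_density Y (exp_density f).
Proof.
move=> [mf f0 If] cf YX; have mg := measurable_exp_density mf.
have g0 y := exp_density_ge0 y f0.
have mYX : measurable_fun setT (fun w => expR (X w)) by exact: measurableT_comp.
pose eXM := isMeasurableFun.Build _ _ _ _ _ mYX.
pose eX : {RV P >-> R} := HB.pack (fun w => expR (X w)) eXM.
have YE A : measurable A -> distribution P Y A = distribution P eX A.
  exact: ae_eq_distribution.
have pos a : 0 < a ->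
    distribution P Y `[a, +oo[ = (\int[leb]_(y in `[a, +oo[) (exp_density f y)%:E)%E.
  move=> a0; rewrite YE//.
  transitivity (distribution P X `[ln a, +oo[).
    congr (P _); apply/seteqP; split=> w /=; rewrite !in_itv/= !andbT.
      by move=> aXw; rewrite -ler_expR lnK.
    by move=> aXw; rewrite -(@lnK _ a)// ler_expR.
  rewrite If// ge0_integral_substitution_ln//; apply: eq_integral => y.
  rewrite inE/= in_itv/= andbT => ay; rewrite exp_densityE//.
  exact: lt_le_trans ay.
apply: has_density_itvcy => // a; have [a0|/pos//] := leP a 0.
pose F n : set R := `[n.+1%:R^-1, +oo[%classic.
have FE : \bigcup_n F n = `]0, +oo[%classic.
  apply/seteqP; split=> [x [n _]|x].
    rewrite /F/= !in_itv/= !andbT; apply: lt_le_trans.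
    by rewrite invr_gt0.
  rewrite /= in_itv/= andbT => x0.
  have [n nx] : exists n, n.+1%:R^-1 < x.
    by have [n] := ltr_add_invr x0; rewrite add0r => nx; exists n.
  by exists n => //; rewrite /F/= in_itv/= andbT ltW.
have ndF : nondecreasing_seq F.
  move=> m n mn; rewrite subsetEset => x; rewrite /F/= !in_itv/= !andbT.
  by apply: le_trans; rewrite lef_pV2// ?posrE// ler_nat.
transitivity (distribution P Y `]0, +oo[).
  rewrite !YE//; congr (P _); apply/seteqP; split=> w /=; rewrite !in_itv/= !andbT => _.
    exact: expR_gt0.
  by rewrite (le_trans a0)// expR_ge0.
transitivity (\int[leb]_(y in `]0%R, +oo[) (exp_density f y)%:E)%E; last first.
  rewrite [LHS]integral_mkcond [RHS]integral_mkcond; apply: eq_integral => y _.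
  rewrite !patchE; have [y0|y0] := leP y 0.
    by rewrite exp_density_le0// !if_same.
  by rewrite !mem_set//= in_itv/= andbT// (le_trans a0)// ltW.
have mF n : measurable (F n) by exact: measurable_itv.
have cvgY : distribution P Y (F n) @[n --> \oo] --> distribution P Y `]0, +oo[.
  by rewrite -FE; apply: nondecreasing_cvg_mu => //; rewrite FE.
have cvgg : (\int[leb]_(y in F n) (exp_density f y)%:E @[n --> \oo] -->
    \int[leb]_(y in `]0%R, +oo[) (exp_density f y)%:E)%E.
  rewrite -FE; apply: ge0_nondecreasing_set_cvg_integral => //.
  - by move=> n; apply: measurable_funTS; exact/measurable_EFinP.
  - by move=> n x _; rewrite lee_fin.
apply: cvg_unique cvgY _ => //.
have -> : (fun n => distribution P Y (F n)) =
    (fun n => \int[leb]_(y in F n) (exp_density f y)%:E)%E; last exact: cvgg.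
by apply/funext => n; apply: pos; rewrite invr_gt0.
Qed.

End exp_density.

(** * Entropy of the exponential of a random variable *)

(** Almost surely [ln (g Y) = ln (f X) - X] for the density [g] of [Y]: the
    logarithm of the quotient splits because the density [f] is positive at [X]
    with probability one. *)
Lemma entropy_expR {R : realType} {d} {T : measurableType d} (P : probability T R)
    (X Y : {RV P >-> R}) (f : R -> R) :
  has_density X f -> continuous f -> P.-integrable setT (EFin \o X) ->
  {ae P, forall w, Y w = expR (X w)} ->
  entropy Y = (entropy X + 'E_P[X])%E.
Proof.
move=> Xf cf iX YX; have Yg := has_density_expR Xf cf YX.
have [mf f0 _] := Xf; have [mg g0 _] := Yg.
have mlnfX : measurable_fun setT (fun w => ln (f (X w))).
  by apply: measurableT_comp => //; exact: measurableT_comp.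
have iNX : P.-integrable setT (EFin \o (fun w => - X w)) by exact: (integrableN iX).
have /fineK EXfin := integrable_fin_num measurableT iX.
rewrite (entropyE Yg) (entropyE Xf) unlock.
have -> : (\int[P]_w (ln (exp_density f (Y w)))%:E =
    \int[P]_w (ln (f (X w)) + - X w)%:E)%E.
  apply: ae_eq_integral => //.
  - apply/measurable_EFinP; apply: measurableT_comp => //.
    exact: measurableT_comp.
  - apply/measurable_EFinP; apply: measurable_funD => //.
    exact: measurableT_comp.
  - apply: filterS2 YX (density_gt0_ae Xf) => w /= -> fX _.
    rewrite exp_densityE ?expR_gt0// expRK ln_div ?posrE ?expR_gt0//.
    by rewrite expRK.
rewrite (integralDr_integrable mlnfX iNX) -EXfin.
rewrite (_ : (\int[P]_w (- X w)%:E = - (\int[P]_w (X w)%:E))%E); last first.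
  by rewrite -integralN//; exact: integrable_add_def.
by rewrite -EXfin oppeD ?oppeK// fin_num_adde_defl.
Qed.

(** * Integrating a derivative over the line *)

Section ftc_line.
Context {R : realType}.
Notation leb := (@lebesgue_measure R).

(** The fundamental theorem of calculus gives the integral of [h] from [- n] to
    [n]; dominated convergence, with [|h|] as bound, lets [n] go to infinity. *)
Lemma integral_derivative_line (h F : R -> R) (l l' : R) :
  continuous h -> leb.-integrable setT (EFin \o h) ->
  (forall x : R, is_derive x 1 F (h x)) ->
  F x @[x --> -oo] --> l -> F x @[x --> +oo] --> l' ->
  (\int[leb]_x (h x)%:E = (l' - l)%:E)%E.
Proof.
move=> ch ih dF Fl Fl'.
have cF (x : R) : {for x, continuous F}.
  by apply: differentiable_continuous; apply/derivable1_diffP; exact: ex_derive.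
(* [n.+1] rather than [n]: the fundamental theorem asks for distinct endpoints. *)
pose D n : set R := `[- n.+1%:R, n.+1%:R]%classic.
have intD n : (\int[leb]_(x in D n) (h x)%:E = (F n.+1%:R - F (- n.+1%:R))%:E)%E.
  rewrite /D (@continuous_FTC2 _ h F).
  - by rewrite EFinB.
  - by rewrite gtrN.
  - exact: continuous_subspaceT.
  - split; first by move=> x _; exact: ex_derive.
      exact/cvg_at_right_filter/cF.
    exact/cvg_at_left_filter/cF.
  - by move=> x _; rewrite derive1E; apply: derive_val.
have mh : measurable_fun setT (EFin \o h) by exact: measurable_int ih.
have mhD n : measurable_fun setT ((EFin \o h) \_ (D n)).
  by apply/(measurable_restrictT _ _).1; [exact: measurable_itv|exact: measurable_funTS].
have hD : {ae leb, forall x, setT x ->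
    ((EFin \o h) \_ (D n)) x @[n --> \oo] --> (EFin \o h) x}.
  apply: aeW => x _; apply: cvg_near_cst; near=> n.
  rewrite patchE mem_set// /D/= in_itv/= -ler_norml.
  rewrite (@le_trans _ _ n%:R)// ?ler_nat//; near: n; exact: nbhs_infty_ger.
have hle : {ae leb, forall x, forall n : nat, setT x ->
    (`|((EFin \o h) \_ (D n)) x| <= (abse \o (EFin \o h)) x)%E}.
  by apply: aeW => x n _; rewrite patchE; case: ifPn => _ /=; rewrite ?lexx// normr0 lee_fin.
have [_ _ intDh] := @dominated_convergence _ (measurableTypeR R) _ leb setT
  measurableT _ _ _ mhD mh hD (integrable_abse ih) hle.
apply: cvg_unique intDh _ => //.
have -> : (fun n => \int[leb]_x ((EFin \o h) \_ (D n)) x)%E =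
    (fun n => (F n.+1%:R - F (- n.+1%:R))%:E).
  by apply/funext => n; rewrite -integral_mkcond intD.
apply: cvg_EFin; first exact: nearW.
have Soo : (n.+1%:R : R) @[n --> \oo] --> +oo.
  by rewrite (cvg_shiftS (fun n => n%:R : R)); exact: cvgr_idn.
apply: cvgB; first exact: cvg_comp Soo Fl'.
by move/cvgNy_compNP : Fl => Fl; exact: cvg_comp Soo Fl.
Unshelve. all: by end_near. Qed.

End ftc_line.

(** * Normal densities and the standard normal distribution function *)

Section normal.
Context {R : realType}.
Notation leb := (@lebesgue_measure R).
Implicit Types m s x : R.

Lemma is_derive_normal_pdf m s x : s != 0 ->
  is_derive x 1 (normal_pdf m s) (- ((x - m) / s ^+ 2) * normal_pdf m s x).
Proof.
move=> s0; rewrite normal_pdfE//.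
pose e : R -> R := - (s ^+ 2 *+ 2)^-1 \*: ((id - cst m : R -> R) ^+ 2).
have eE : normal_fun m s = expR \o e.
  apply/funext => y.
  have -> : (expR \o e) y = expR (- (s ^+ 2 *+ 2)^-1 * (y - m) ^+ 2) by [].
  by rewrite /normal_fun !mulNr mulrC.
have de : is_derive x 1 e (- ((x - m) / s ^+ 2)).
  apply: is_derive_eq.
  rewrite subr0 expr1 -![_ *: _]/(_ * _) mulr1 -[(id - cst m) x]/(x - m); field.
  by rewrite s0.
have dN : is_derive x 1 (normal_peak s \*: (expR \o e))
    (normal_peak s *: (expR (e x) * - ((x - m) / s ^+ 2))).
  by apply: is_deriveZ; exact: is_derive1_comp.
have -> : (fun x => normal_peak s * normal_fun m s x) = normal_peak s \*: (expR \o e).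
  by rewrite -eE.
apply: (is_derive_eq dN); rewrite eE -[_ *: _]/(_ * _) mulrA mulrC.
by [].
Qed.

Lemma cvg_normal_pdfy m s : s != 0 -> normal_pdf m s x @[x --> +oo] --> 0.
Proof.
move=> s0; rewrite normal_pdfE// -[X in _ --> X](mulr0 (normal_peak s)).
apply: cvgM; first exact: cvg_cst.
rewrite /normal_fun; under eq_fun do rewrite mulNr.
apply: cvg_comp (@cvgr_expR R).
apply: gt0_cvgMly; first by rewrite invr_gt0 mulrn_wgt0// exprn_even_gt0.
apply: cvg_comp cvgr_expr2; exact: cvg_addrr.
Qed.

Lemma cvg_normal_pdfNy m s : s != 0 -> normal_pdf m s x @[x --> -oo] --> 0.
Proof.
move=> s0; apply/cvgNy_compNP.
have -> : normal_pdf m s \o -%R = normal_pdf (- m) s; last exact: cvg_normal_pdfy.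
apply/funext => x; rewrite /= !normal_pdfE// /normal_fun.
by rewrite -opprD sqrrN opprK.
Qed.

(** A linear factor is absorbed by spreading the Gaussian: in terms of
    [y = (x - m) / (2 * s)], the inequality is [|y| * exp (- y^2) <= 1]. This makes
    [x * N m s x] integrable without computing any moment. *)
Lemma normal_fun_widen m s x : s != 0 ->
  `|x - m| * normal_fun m s x <= 2 * `|s| * normal_fun m (Num.sqrt 2 * s) x.
Proof.
move=> s0; pose y := (x - m) / (2 * s).
have xmE : x - m = 2 * s * y by rewrite /y; field.
move: y xmE => y xmE.
have -> : normal_fun m s x = expR (- y ^+ 2) * expR (- y ^+ 2).
  rewrite -expRD /normal_fun xmE; congr expR; field.
  by rewrite s0.
have -> : normal_fun m (Num.sqrt 2 * s) x = expR (- y ^+ 2).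
  rewrite /normal_fun (_ : (Num.sqrt 2 * s) ^+ 2 = 2 * s ^+ 2); last first.
    by rewrite exprMn sqr_sqrtr.
  rewrite xmE; congr expR; field.
  by rewrite s0.
rewrite xmE !normrM (ger0_norm (ler0n _ 2)) -!mulrA.
apply: ler_wpM2l => //; apply: ler_wpM2l => //.
(* [|y| <= 1 + y^2 <= exp (y^2)] *)
rewrite mulrA; apply: ler_piMl; first exact: expR_ge0.
rewrite expRN ler_pdivrMr ?expR_gt0// mul1r (le_trans _ (expR_ge1Dx _))//.
have := sqr_ge0 (`|y| - 1); rewrite -(real_normK (num_real y)).
by have := normr_ge0 y; nra.
Qed.

Lemma integrable_mul_normal_pdf m s : s != 0 ->
  leb.-integrable setT (fun x => (x * normal_pdf m s x)%:E).
Proof.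
move=> s0; have s20 : Num.sqrt 2 * s != 0 by rewrite mulf_neq0// gt_eqF// sqrtr_gt0.
have mN : measurable_fun setT (normal_pdf m s) by exact: measurable_normal_pdf.
have i1 : leb.-integrable setT (fun x => ((x - m) * normal_pdf m s x)%:E).
  (* the constant of [normal_fun_widen], corrected by the ratio of the peaks *)
  pose c := normal_peak s * (2 * `|s|) / normal_peak (Num.sqrt 2 * s).
  apply: (le_integrable measurableT _ _
    (integrableZl measurableT c (integrable_normal_pdf m (Num.sqrt 2 * s)))).
    apply/measurable_EFinP; apply: measurable_funM => //.
    exact: measurable_funB.
  move=> x _; rewrite -EFinM !abse_EFin lee_fin.
  have c0 : 0 <= c by rewrite divr_ge0 ?normal_peak_ge0// mulr_ge0 ?normal_peak_ge0// mulr_ge0.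
  rewrite [leLHS]normrM (ger0_norm (normal_pdf_ge0 _ _ _)).
  rewrite [leRHS]ger0_norm; last by rewrite mulr_ge0// normal_pdf_ge0.
  rewrite !normal_pdfE// /c [leRHS]mulrA divfK ?gt_eqF ?normal_peak_gt0//.
  by rewrite mulrCA -mulrA ler_wpM2l ?normal_peak_ge0// normal_fun_widen.
have i2 := integrableD measurableT i1 (integrableZl measurableT m (integrable_normal_pdf m s)).
apply: eq_integrable i2 => // x _.
by rewrite /= -EFinM -EFinD -mulrDl subrK.
Qed.

Lemma std_normal_cdf_ge0 x : 0 <= std_normal_cdf x.
Proof. exact/fine_ge0/measure_ge0. Qed.

Lemma std_normal_cdf_le1 x : std_normal_cdf x <= 1.
Proof.
rewrite -lee_fin fineK ?fin_num_measure//; exact: probability_le1.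
Qed.

Lemma is_derive_std_normal_cdf x :
  is_derive x 1 (@std_normal_cdf R) (std_normal_pdf x).
Proof.
have [||||d] := @continuous_FTC1 _ (normal_pdf 0 1) -oo%O x (x + 1).
- by rewrite ltrDl.
- by apply: integrableS (integrable_normal_pdf 0 1).
- by rewrite ltNyr.
- by apply: continuous_normal_pdf; exact: oner_neq0.
by rewrite derive1E => dE; split.
Qed.

End normal.

(** * The mean of the skew-normal distribution *)

Section skew_normal_mean.
Context {R : realType}.
Notation leb := (@lebesgue_measure R).
Variables (mu sigma alpha : R).
Hypothesis sigma0 : 0 < sigma.
Let sigma_neq0 : sigma != 0. Proof. by rewrite gt_eqF. Qed.
Notation S := (skew_normal_pdf mu sigma alpha).

Lemma normal_pdf_std x :
  normal_pdf mu sigma x = std_normal_pdf ((x - mu) / sigma) / sigma.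
Proof.
rewrite /std_normal_pdf !normal_pdfE ?oner_neq0//.
have -> : normal_peak sigma = normal_peak 1 / sigma.
  rewrite /normal_peak -!mulrnAr sqrtrM ?sqr_ge0// sqrtr_sqr gtr0_norm//.
  by rewrite expr1n mul1r invfM mulrC.
rewrite mulrAC; congr (_ * _ / _); rewrite /normal_fun; congr expR; field.
exact: sigma_neq0.
Qed.

Lemma skew_normal_pdfE x :
  S x = 2 * normal_pdf mu sigma x * std_normal_cdf (alpha * ((x - mu) / sigma)).
Proof. by rewrite /skew_normal_pdf normal_pdf_std; congr (_ * _); ring. Qed.

Lemma skew_normal_pdf_le x : `|S x| <= 2 * normal_pdf mu sigma x.
Proof.
have N0 : 0 <= 2 * normal_pdf mu sigma x by rewrite mulr_ge0// normal_pdf_ge0.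
rewrite skew_normal_pdfE normrM (ger0_norm N0) ger0_norm ?std_normal_cdf_ge0//.
by rewrite ler_piMr// std_normal_cdf_le1.
Qed.

Local Notation s := (sigma / Num.sqrt (1 + alpha ^+ 2)).

Let sqrt1a_gt0 : 0 < Num.sqrt (1 + alpha ^+ 2).
Proof. by rewrite sqrtr_gt0 ltr_pwDl// sqr_ge0. Qed.

Let s_neq0 : s != 0.
Proof. by rewrite mulf_neq0// invr_eq0 gt_eqF. Qed.

Local Notation c := (alpha / (Num.sqrt (pi *+ 2) * Num.sqrt (1 + alpha ^+ 2))).

(** With [u = (x - mu) / sigma], the exponents add up to that of [N mu s]:
    [u^2 / 2 + (alpha * u)^2 / 2 = (x - mu)^2 / (2 * s^2)]. *)
Lemma normal_pdf_mul_std_normal_pdf x :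
  normal_pdf mu sigma x * (std_normal_pdf (alpha * ((x - mu) / sigma)) * alpha) =
  c * normal_pdf mu s x.
Proof.
rewrite /std_normal_pdf !normal_pdfE ?oner_neq0//.
have s2 : s ^+ 2 = sigma ^+ 2 / (1 + alpha ^+ 2).
  by rewrite expr_div_n sqr_sqrtr// addr_ge0// sqr_ge0.
have a0 : 1 + alpha ^+ 2 != 0 by rewrite gt_eqF// ltr_pwDl// sqr_ge0.
have -> : normal_fun mu s x =
    normal_fun mu sigma x * normal_fun 0 1 (alpha * ((x - mu) / sigma)).
  rewrite /normal_fun -expRD s2; congr expR; field.
  by rewrite a0 sigma_neq0.
have sqrtpi0 : Num.sqrt (pi *+ 2 : R) != 0 by rewrite gt_eqF// sqrtr_gt0 mulrn_wgt0// pi_gt0.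
have -> : normal_peak s = normal_peak sigma * Num.sqrt (1 + alpha ^+ 2).
  rewrite /normal_peak s2 -!mulrnAr sqrtrM ?divr_ge0 ?sqr_ge0 ?addr_ge0 ?sqr_ge0//.
  rewrite [in RHS]sqrtrM ?sqr_ge0// sqrtrM ?sqr_ge0// sqrtrV ?addr_ge0 ?sqr_ge0//.
  rewrite sqrtr_sqr gtr0_norm//; field.
  by rewrite sigma_neq0 sqrtpi0 gt_eqF.
have -> : normal_peak (1 : R) = (Num.sqrt (pi *+ 2))^-1.
  by rewrite /normal_peak expr1n mul1r.
field.
by rewrite sqrtpi0 gt_eqF.
Qed.

Local Notation F := (fun x : R => - sigma ^+ 2 * S x).

(** In [S = 2 * N mu sigma * Phi], differentiating the normal density produces
    the factor [- (x - mu) / sigma^2], which [- sigma^2] turns into [x - mu];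
    differentiating [Phi] produces a product of two Gaussians. *)
Lemma is_derive_skew_normal_pdf (x : R) :
  is_derive x 1 F ((x - mu) * S x - 2 * sigma * c * normal_pdf mu s x).
Proof.
pose u : R -> R := (alpha / sigma) \*: (id - cst mu : R -> R).
have du : is_derive x 1 u (alpha / sigma).
  by apply: is_derive_eq; rewrite subr0 -[_ *: _]/(_ * _) mulr1.
have dPhi := @is_derive1_comp _ (@std_normal_cdf R) u _ _ _
  (is_derive_std_normal_cdf (u x)) du.
have dN := is_derive_normal_pdf mu x sigma_neq0.
have dS := is_deriveZ (- sigma ^+ 2 * 2) (is_deriveM dN dPhi).
have uE y : u y = alpha * ((y - mu) / sigma).
  by rewrite -[u y]/(_ * (y - mu)) mulrAC mulrA.
have -> : F = (- sigma ^+ 2 * 2) \*: (normal_pdf mu sigma * (@std_normal_cdf R \o u)).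
  apply/funext => y; rewrite skew_normal_pdfE.
  rewrite -[RHS]/(_ * (normal_pdf mu sigma y * std_normal_cdf (u y))) uE.
  by rewrite !mulrA.
apply: (is_derive_eq dS).
rewrite -![_ *: _]/(_ * _) -[(_ \o u) x]/(std_normal_cdf (u x)) uE skew_normal_pdfE.
rewrite -(mulrA (2 * sigma)) -normal_pdf_mul_std_normal_pdf; field.
exact: sigma_neq0.
Qed.

Lemma continuous_skew_normal_pdf : continuous S.
Proof.
move=> x; rewrite (_ : skew_normal_pdf _ _ _ = (- sigma ^+ 2)^-1 \*: F); last first.
  apply/funext => y; rewrite -[RHS]/(_ * (- sigma ^+ 2 * S y)) mulKf//.
  by rewrite oppr_eq0 expf_neq0.
apply: differentiable_continuous; apply/derivable1_diffP.
by apply: derivableZ; have [] := is_derive_skew_normal_pdf x.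
Qed.

Lemma integrable_mul_skew_normal_pdf : leb.-integrable setT (fun x => (x * S x)%:E).
Proof.
apply: (le_integrable measurableT _ _
  (integrableZl measurableT 2 (integrable_mul_normal_pdf mu sigma_neq0))).
  apply/measurable_EFinP; apply: measurable_funM => //.
  exact: continuous_measurable_fun continuous_skew_normal_pdf.
move=> x _; rewrite -EFinM !abse_EFin lee_fin.
rewrite [leLHS]normrM [leRHS]normrM [X in _ <= _ * X]normrM.
rewrite [leRHS]mulrCA; apply: ler_wpM2l => //.
apply: (le_trans (skew_normal_pdf_le x)).
by apply: ler_pM => //; rewrite ?normal_pdf_ge0// ler_norm.
Qed.

Lemma cvg_skew_normal_pdf0 (G : set_system R) {FG : Filter G} :
  normal_pdf mu sigma x @[x --> G] --> 0 -> F x @[x --> G] --> 0.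
Proof.
move=> N0; rewrite -[X in _ --> X](mulr0 (- sigma ^+ 2)).
apply: cvgM; first exact: cvg_cst.
apply/norm_cvg0P; apply: (@squeeze_cvgr _ _ _ _ (cst 0) (fun x => 2 * normal_pdf mu sigma x)).
- by apply: nearW => x; rewrite normr_ge0 skew_normal_pdf_le.
- exact: cvg_cst.
- by rewrite -[X in _ --> X](mulr0 2); apply: cvgM => //; exact: cvg_cst.
Qed.

(** The derivative [h] of [- sigma^2 * S] has integral [0], and
    [x * S x = h x + mu * S x + k * N mu s x] where [S] and [N mu s] have mass
    one. *)
Lemma integral_mul_skew_normal_pdf :
  (\int[leb]_x (S x)%:E = 1)%E ->
  (\int[leb]_x (x * S x)%:E =
   (mu + sigma * Num.sqrt (2 / pi) * (alpha / Num.sqrt (1 + alpha ^+ 2)))%:E)%E.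
Proof.
move=> S1.
have iS : leb.-integrable setT (EFin \o S).
  apply: (le_integrable measurableT _ _
    (integrableZl measurableT 2 (integrable_normal_pdf mu sigma))).
    by apply/measurable_EFinP; exact: continuous_measurable_fun continuous_skew_normal_pdf.
  move=> x _; rewrite -EFinM !abse_EFin lee_fin.
  by rewrite (le_trans (skew_normal_pdf_le x))// ler_norm.
pose k := 2 * sigma * c.
pose h x := (x - mu) * S x - k * normal_pdf mu s x.
have iN := integrable_normal_pdf mu s.
have iNk := integrableZl measurableT k iN.
have iSm := integrableZl measurableT mu iS.
have ih0 := integrableB measurableT
  (integrableB measurableT integrable_mul_skew_normal_pdf iSm) iNk.
have ih : leb.-integrable setT (EFin \o h).
  apply: eq_integrable ih0 => // x _; rewrite /h/=; congr EFin; ring.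
have ch : continuous h.
  move=> x; apply: cvgB; apply: cvgM.
  - by apply: cvgB; [exact: cvg_id|exact: cvg_cst].
  - exact: continuous_skew_normal_pdf.
  - exact: cvg_cst.
  - exact: continuous_normal_pdf.
have h0 : (\int[leb]_x (h x)%:E = 0)%E.
  have FNy : F x @[x --> -oo] --> 0.
    by apply: cvg_skew_normal_pdf0; exact: cvg_normal_pdfNy.
  have Fy : F x @[x --> +oo] --> 0.
    by apply: cvg_skew_normal_pdf0; exact: cvg_normal_pdfy.
  rewrite (integral_derivative_line ch ih is_derive_skew_normal_pdf FNy Fy).
  by rewrite subrr.
transitivity (\int[leb]_x
    ((h x)%:E + (mu%:E * (S x)%:E + k%:E * (normal_pdf mu s x)%:E)))%E.
  by apply: eq_integral => x _; rewrite -!EFinM -!EFinD /h; congr EFin; ring.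
rewrite integralD//; last exact: integrableD.
rewrite h0 add0e integralD// integralZl// integralZl// S1 integral_normal_pdf.
rewrite !mule1 -EFinD /k; congr (_ + _)%:E.
have pi2_gt0 : 0 < Num.sqrt (pi *+ 2 : R) by rewrite sqrtr_gt0 mulrn_wgt0 ?pi_gt0.
have -> : Num.sqrt (2 / pi) = 2 / Num.sqrt (pi *+ 2) :> R.
  have -> : 2 / pi = 2 ^+ 2 / (pi *+ 2) :> R.
    by rewrite expr2 -[pi *+ 2]mulr_natr -mulf_div divff ?mulr1.
  by rewrite sqrtrM ?sqr_ge0// sqrtr_sqr ger0_norm// sqrtrV// mulrn_wge0 ?pi_ge0.
by field; rewrite !gt_eqF.
Qed.

End skew_normal_mean.

(** * The entropy of the log-skew-normal distribution *)

Theorem proposition1 (R : realType) (mu sigma alpha : R)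
    (dX : measure_display) (TX : measurableType dX) (PX : probability TX R)
    (X : {RV PX >-> R})
    (dY : measure_display) (TY : measurableType dY) (PY : probability TY R)
    (Y : {RV PY >-> R}) :
  0 < sigma ->
  skew_normal X mu sigma alpha ->
  log_skew_normal Y mu sigma alpha ->
  entropy Y = (entropy X + 'E_PX[X])%E /\
  ('E_PX[X] = (mu + sigma * Num.sqrt (2 / pi) *
                    (alpha / Num.sqrt (1 + alpha ^+ 2)))%R%:E)%E.
Proof.
move=> sigma0 XS [X' X'S YX'].
have cS := @continuous_skew_normal_pdf _ mu _ alpha sigma0.
have [mS _ IS] := XS.
have mln : measurable_fun setT (fun x => ln (skew_normal_pdf mu sigma alpha x)).
  by apply: measurableT_comp => //; exact: measurable_ln.
have EX' : ('E_PY[X'] = 'E_PX[X])%E.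
  by rewrite (expectation_density X'S (h := id))// (expectation_density XS (h := id)).
have HX' : entropy X' = entropy X.
  by rewrite (entropyE X'S) (entropyE XS) (expectation_density X'S mln)
    (expectation_density XS mln).
have iX' : PY.-integrable setT (EFin \o X').
  apply: (integrable_density X'S (h := id)) => //.
  exact: integrable_mul_skew_normal_pdf.
split; first by rewrite (entropy_expR X'S cS iX' YX') HX' EX'.
rewrite (expectation_density XS (h := id))//.
by apply: integral_mul_skew_normal_pdf => //; rewrite -IS// probability_setT.
Qed.
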